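(* If $q=18n+1$ is a prime power with $n$ odd, then there exists a $(\mathbb Z_3\times\mathbb F_q,\{3^{12n+1},6^{3n}\},3)$-PDF which is the base (starter) parallel class of an HS$(2,\{3,6\},3q)$.
   Context: For a subset $B$ of an additive group, $\Delta B$ is the multiset of differences $b-b'$ over ordered pairs of distinct elements of $B$. A $(\Gamma,K,\lambda)$-PDF is a collection of subsets of $\Gamma$ partitioning $\Gamma$, with multiset of sizes $K$ (exponential notation: $\{k_1^{\mu_1},\dots\}$ means $k_i$ with multiplicity $\mu_i$), such that the multiset union of the $\Delta B$ equals $\lambda$ copies of $\Gamma\setminus\{0\}$. A linear space S$(2,K,v)$: $v$ points, blocks with sizes in $K$ (each element of $K$ occurring), every pair of points in exactly one block; a resolution partitions the blocks into parallel classes each partitioning the points. A PDF $\mathcal P$ in $\Gamma$ with $|\Gamma|=v$ is the base parallel class of an HS$(2,K,v)$ if $\{\mathcal P+x\mid x\in\Gamma\}$ is the set of parallel classes of a resolved S$(2,K,v)$ with point set $\Gamma$ (so the translations act sharply transitively on points and transitively on parallel classes). *)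

(* Defs.v *)
From HB Require Import structures.
From mathcomp Require Import all_boot all_order all_algebra.
Set Implicit Arguments.
Unset Strict Implicit.
Unset Printing Implicit Defensive.
Import GRing.Theory.
Local Open Scope ring_scope.

(* Makes products of finZmodTypes canonically finZmodTypes. *)
HB.saturate prod.

(* Multisets are represented by sequences considered up to perm_eq. *)

Definition prime_power (q : nat) : Prop :=
  exists p k : nat, [/\ prime p, (0 < k)%N & q = (p ^ k)%N].

Section DifferenceFamilies.

Variable G : finZmodType.

Definition Delta (B : {set G}) : seq G :=
  [seq b.1 - b.2 | b in [set b : G * G | [&& b.1 \in B, b.2 \in B & b.1 != b.2]]].

Definition is_PDF (K : seq nat) (lambda : nat) (P : {set {set G}}) : Prop :=
  [/\ partition P [set: G],
      perm_eq [seq #|B| | B : {set G} in P] K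
    & perm_eq (flatten [seq Delta B | B : {set G} in P])
              (flatten (nseq lambda (enum [set~ (0 : G)])))].

Definition translate (P : {set {set G}}) (x : G) : {set {set G}} :=
  [set [set b + x | b in B] | B : {set G} in P].

End DifferenceFamilies.

Section LinearSpaces.

Variable T : finType.

(* K is read as a set of sizes. A set of blocks (rather than a multiset) loses
   nothing here, as a block with at least two points cannot be repeated. *)
Definition is_linear_space (K : seq nat) (v : nat) (L : {set {set T}}) : Prop :=
  [/\ #|T| = v,
      forall B : {set T}, B \in L -> #|B| \in K,
      forall k : nat, k \in K -> exists2 B : {set T}, B \in L & #|B| = k
    & forall x y : T, x != y ->
        exists! B : {set T}, [/\ B \in L, x \in B & y \in B]].

Definition is_resolution (L : {set {set T}}) (R : {set {set {set T}}}) : Prop :=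
  partition R L /\ (forall C : {set {set T}}, C \in R -> partition C [set: T]).

End LinearSpaces.

(* The parallel classes form the set of distinct translates of P, so P may have
   a nontrivial stabilizer in G. *)
Definition is_base_parallel_class_HS (G : finZmodType) (K : seq nat) (v : nat)
    (P : {set {set G}}) : Prop :=
  exists2 L : {set {set G}}, is_linear_space K v L
    & is_resolution L [set translate P x | x : G].

(* Main.v *)
Require Import Defs.
From mathcomp Require Import all_boot all_order all_algebra.
From mathcomp Require Import cyclic finfield zify ring lra.

Set Implicit Arguments.
Unset Strict Implicit.
Unset Printing Implicit Defensive.

(** The partition [P] is taken invariant under [Z_3 x 0]: it consists of
    [Z_3 x {0}] and of the [Z_3]-translates of [n] hexads and [4n] triples whose
    projections partition [F^*] and whose differences cover each [(c, d)],
    [d <> 0], exactly once.  Let [e] be a primitive cube root of unity,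
    [U = <e>] and [theta = e - 1].  All blocks are multiples, by representatives
    modulo [U] of the sixth powers, of five base blocks that are unions of
    [U]-orbits, so that only classes modulo sixth powers matter; as [n] is odd,
    [-1] lies in class [3].

    Let [w] be such that [w - 1, w - e, w - e^2] lie in distinct cubic classes.
    - If [w] is not a cube, take the hexad [{0} x U + {1} x wU], the triple
      [{0} x w^2 U] and twisted triples [{(+-i, -x e^i)}] for [x = 1, w, w^2].
    - If [w] is a cube but not a square, rotate it by [U] so that [w - 1] has the
      cubic class of [theta], and take the hexad [{(i, e^i)} + {(i, w e^i)}], the
      triples [{0} x yU] and twisted triples [{(+-i, -y e^i)}] for [y = g, g^2].
    In both cases the directions of the twists are free and are used to correct
    the quadratic classes of the differences.

    Some [w] is not a sixth power: the number [N] of all [w] satisfies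
    [9 N = 2 q + 2 + 2 J], where the Jacobi type sum [J] satisfies
    [J^2 <= 6 q] by a second moment computation, and this exceeds the number of
    sixth powers outside [U]. *)

(** * Partitions into fibres and their translates *)

Section Fibres.
Local Open Scope ring_scope.
Import GRing.Theory.
Variables (G : finZmodType) (T : eqType) (f : G -> T).

Definition fibres : {set {set G}} := preim_partition f [set: G].

Definition fibre x : {set G} := [set y | f x == f y].

Lemma fibresP B : reflect (exists x, B = fibre x) (B \in fibres).
Proof.
apply: (iffP imsetP) => [[x _ ->]|[x ->]]; exists x => //;
  by apply/setP => y; rewrite !inE.
Qed.

Lemma fibre_in x : fibre x \in fibres. Proof. by apply/fibresP; exists x. Qed.

Lemma fibres_partition : partition fibres [set: G].
Proof. exact: preim_partitionP. Qed.

Lemma count_Delta (B : {set G}) d :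
  count_mem d (Delta B) = #|[set p : G * G
    | [&& p.1 \in B, p.2 \in B, p.1 != p.2 & p.1 - p.2 == d]]|.
Proof.
rewrite /Delta count_map cardE /enum_mem -!enumT -size_filter -filter_predI.
by congr size; apply: eq_filter => p; rewrite !inE /= andbC -!andbA.
Qed.

Lemma count_fibres_Delta d :
  count_mem d (flatten [seq Delta B | B : {set G} in fibres]) =
  #|[set p : G * G | [&& f p.1 == f p.2, p.1 != p.2 & p.1 - p.2 == d]]|.
Proof.
rewrite count_flatten -map_comp sumnE big_map big_enum /=.
under eq_bigr do rewrite count_Delta -sum1_card big_mkcond /=.
rewrite exchange_big /= -sum1_card [RHS]big_mkcond /=; apply: eq_bigr => p _.
rewrite inE (bigD1 (fibre p.1)) ?fibre_in //= !inE eqxx big1 => [|B].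
  by rewrite addn0.
case/andP=> /fibresP[x ->]; rewrite !inE.
case: (f x =P f p.1) => //= fx; apply: contraNeq => _.
by apply/eqP/setP => y; rewrite !inE fx.
Qed.

Lemma card_fibre k :
  (k * count_mem k [seq #|B| | B : {set G} in fibres])%N = #|[set x | #|fibre x| == k]|.
Proof.
rewrite cardsE -sum1_card big_mkcond (eq_bigl (mem [set: G])) => [|x];
  last by rewrite /= in_setT.
rewrite /= (set_partition_big _ fibres_partition) /=.
rewrite -sum1_count big_map big_mkcond big_enum /= big_distrr /=.
apply: eq_bigr => _ /fibresP[x ->].
rewrite (eq_bigr (fun _ => (#|fibre x| == k) : nat)) => [|y]; last first.
  rewrite inE => /eqP fxy; rewrite unfold_in /= (_ : fibre y = fibre x);
    first by rewrite -eqnE; case: eqn.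
  by apply/setP => z; rewrite !inE fxy.
by rewrite sum_nat_const; case: eqP => [->|_]; rewrite ?muln1 ?muln0.
Qed.

(** Points are easier to count than blocks: the point counts for the two sizes determine the
    multiset of block sizes. *)
Lemma perm_fibres_size (a b i j : nat) : a != b -> (0 < a)%N -> (0 < b)%N ->
  (forall x, #|fibre x| = a \/ #|fibre x| = b) ->
  #|[set x | #|fibre x| == a]| = (a * i)%N -> #|[set x | #|fibre x| == b]| = (b * j)%N ->
  perm_eq [seq #|B| | B : {set G} in fibres] (nseq i a ++ nseq j b).
Proof.
move=> ab a0 b0 szab; rewrite -!card_fibre => /eqP; rewrite eqn_pmul2l // => /eqP ca /eqP.
rewrite eqn_pmul2l // => /eqP cb.
apply/allP => k; rewrite 2!mem_cat => kab /=.
have /orP[] : (k == a) || (k == b).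
- case/or3P: kab => [/mapP[B]|/nseqP[-> _]|/nseqP[-> _]]; rewrite ?eqxx ?orbT //.
  rewrite mem_enum => /fibresP[x ->] ->.
  by case: (szab x) => ->; rewrite eqxx ?orbT.
- move/eqP=> ->; by rewrite ca count_cat !count_nseq /= eqxx (eq_sym b) (negbTE ab) mul1n
  addn0.
- move/eqP=> ->; by rewrite cb count_cat !count_nseq /= eqxx (negbTE ab) mul1n.
Qed.

End Fibres.

(** * Resolved linear spaces from the translates of a partition *)

Section Starter.
Local Open Scope ring_scope.
Import GRing.Theory.
Variables (U V : finZmodType) (T : eqType) (f : U * V -> T) (K : seq nat).
Let G : finZmodType := (U * V)%type.
(** Two distinct points share a block of the translate by [x] exactly when [x] runs over one coset
    of [U x 0]. Taking [p' = 0] gives the difference count; in general it gives the unique block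
    through two points. *)
Hypothesis f_starter : forall p p' : G, p != p' ->
  exists x0 : V, forall x : G, (f (p - x) == f (p' - x)) = (x.2 == x0).

Lemma f_translate (x x' p p' : G) : x.2 = x'.2 ->
  (f (p - x) == f (p' - x)) = (f (p - x') == f (p' - x')).
Proof.
move=> xx'; have [->|/f_starter[x0 E]] := eqVneq p p'; first by rewrite !eqxx.
by rewrite !E xx'.
Qed.

Lemma starter_Delta :
  perm_eq (flatten [seq Delta B | B : {set G} in fibres f])
          (flatten (nseq #|U| (enum [set~ (0 : G)]))).
Proof.
apply/allP => d _ /=; rewrite count_fibres_Delta count_flatten map_nseq sumn_nseq.
rewrite count_uniq_mem ?enum_uniq // mem_enum !inE mulnC.
have [->|d0] := eqVneq d 0.
  rewrite muln0; apply/eqP/eqP; rewrite cards_eq0; apply/eqP/setP => p; rewrite !inE subr_eq0.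
  by case: (_ == _ :> G); rewrite ?andbF.
rewrite muln1; have [x0 E] := f_starter d0.
(* The pairs of difference [d] inside a block are the translates of (d, 0) by the elements
   [- (u, x0)], one for each [u]. *)
pose h u : G * G := (d - (u, x0), 0 - (u, x0)).
have h_inj : injective h by move=> u u' /(congr1 (fun p : G * G => p.1.1)) /= /subrI.
rewrite -cardsT -(card_imset _ h_inj); apply/eqP/eq_card => -[p p'].
rewrite !inE; apply/and3P/imsetP => [[/= fp _ /eqP pd]|[u _ [-> ->]]]; last first.
  by split; rewrite /= ?E // ?(inj_eq (addIr _)) // opprB addrA subrK subr0.
have E2 := E (- p'); rewrite sub0r !opprK -pd subrK fp in E2.
exists (- p').1; rewrite // /h; have -> : ((- p').1, x0) = - p' by rewrite -(eqP (esym E2));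
  case: (- p').
by rewrite sub0r !opprK -pd subrK.
Qed.

Lemma mem_translate (x : G) (B : {set G}) :
  reflect (exists z : G, B = [set y | f (z - x) == f (y - x)]) (B \in translate (fibres f) x).
Proof.
have E z : [set b + x | b in fibre f (z - x)] = [set y | f (z - x) == f (y - x)].
  apply/setP => y; rewrite inE; apply/imsetP/idP => [[b]|fy].
    by rewrite inE => ? ->; rewrite addrK.
  by exists (y - x); rewrite ?inE // subrK.
apply: (iffP imsetP) => [[C /fibresP[z ->] ->]|[z ->]].
  by exists (z + x); rewrite -E addrK.
by exists (fibre f (z - x)); rewrite ?fibre_in ?E.
Qed.

Hypothesis K_size : forall x : G, #|fibre f x| \in K.
Hypothesis K_all : forall k, k \in K -> exists x : G, #|fibre f x| = k.
Hypothesis K_gt1 : forall k, k \in K -> (1 < k)%N.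

Lemma starter_HS v : #|G| = v -> is_base_parallel_class_HS K v (fibres f).
Proof.
move=> cG; pose R := [set translate (fibres f) x | x : G].
have memR x B : B \in translate (fibres f) x -> B \in cover R.
  by move=> Bx; apply/bigcupP; exists (translate (fibres f) x) => //; apply: imset_f.
have inR B : B \in cover R -> exists x z : G, B = [set y | f (z - x) == f (y - x)].
  by case/bigcupP=> _ /imsetP[x _ ->] /mem_translate[z ->]; exists x, z.
have sizeB (x z : G) : #|[set y | f (z - x) == f (y - x)]| = #|fibre f (z - x)|.
  rewrite -[RHS](card_imset (mem (fibre f (z - x))) (addIr x)); apply: eq_card => y.
  rewrite inE; apply/idP/imsetP => [fy|[b]]; last by rewrite inE => ? ->; rewrite addrK.
  by exists (y - x); rewrite ?inE // subrK.
exists (cover R); split=> //.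
- by move=> B /inR[x [z ->]]; rewrite sizeB.
- move=> k /K_all[z <-]; exists (fibre f z) => //; apply: (memR 0).
  by apply/mem_translate; exists z; apply/setP => y; rewrite !inE !subr0.
- move=> p p' pp'; have [x0 E] := f_starter pp'.
  exists [set y | f (p - (0, x0)) == f (y - (0, x0))]; split.
    by split; rewrite ?inE ?eqxx ?E //; apply: (memR (0, x0)); apply/mem_translate; exists p.
  move=> B [/inR[x [z ->]]]; rewrite !inE => /eqP zp; rewrite zp E => /eqP xx0.
  by apply/setP => y; rewrite !inE; apply: f_translate.
- rewrite /partition eqxx /=; apply/andP; split; last first.
    apply/negP => /imsetP[x _ /setP/(_ [set y | f (x - x) == f (y - x)])].
    by rewrite [in LHS]inE => /esym/mem_translate[]; exists x.
  (* Two points of a common block determine the second coordinate of [x], so classes sharing a block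
     coincide. *)
  apply/trivIsetP => _ _ /imsetP[x _ ->] /imsetP[x' _ ->]; apply: contraNT.
  case/pred0Pn=> B /andP[/mem_translate[z Bx] /mem_translate[z' Bx']].
  have : (1 < #|B|)%N by rewrite Bx sizeB; apply: K_gt1.
  case/card_gt1P=> p [p' [pB p'B pp']].
  have [x0 E] := f_starter pp'.
  have xx0 : x.2 = x0.
    by apply/eqP; rewrite -E; move: pB p'B; rewrite Bx !inE => /eqP <- /eqP <-.
  have xx0' : x'.2 = x0.
    by apply/eqP; rewrite -E; move: pB p'B; rewrite Bx' !inE => /eqP <- /eqP <-.
  apply/eqP/setP => C; apply/mem_translate/mem_translate => -[t ->]; exists t;
  by apply/setP => y; rewrite !inE; apply: f_translate; rewrite xx0 xx0'.
- move=> _ /imsetP[x _ ->]; rewrite /partition; apply/and3P; split.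
  + rewrite eqEsubset subsetT; apply/subsetP => y _; apply/bigcupP.
    exists [set t | f (y - x) == f (t - x)]; last by rewrite inE.
    by apply/mem_translate; exists y.
  + apply/trivIsetP => _ _ /mem_translate[z ->] /mem_translate[z' ->]; apply: contraNT.
    case/pred0Pn=> y; rewrite /= !inE => /andP[/eqP zy /eqP zy'].
    by apply/eqP/setP => t; rewrite !inE zy zy'.
  + by apply/negP => /mem_translate[z /setP/(_ z)]; rewrite !inE eqxx.
Qed.

End Starter.

(** * Cubic residues *)

Section Cyclotomy.
Local Open Scope ring_scope.
Import GRing.Theory Num.Theory.
Variables (F : finFieldType) (n : nat) (g : F).
Hypotheses (cardF : #|F| = (18 * n + 1)%N) (gP : (18 * n).-primitive_root g).

(* The discrete logarithm to base [g], modulo 6; its value at [0] is junk. *)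
Definition index6 (x : F) : nat :=
  if [pick i : 'I_(18 * n) | g ^+ i == x] is Some i then (i %% 6)%N else 0%N.

Lemma n_gt0 : (0 < n)%N.
Proof. by move: (prim_order_gt0 gP); rewrite muln_gt0. Qed.

Lemma g_neq0 : g != 0.
Proof.
apply/eqP => g0; have := prim_expr_order gP; have := n_gt0.
rewrite g0 expr0n muln_eq0 /= => /lt0n_neq0/negbTE-> /eqP.
by rewrite eq_sym oner_eq0.
Qed.

Lemma log_exists x : x != 0 -> exists2 i, (i < 18 * n)%N & x = g ^+ i.
Proof.
move=> x0; have x1 : x ^+ (18 * n) = 1.
  apply: (mulfI x0); rewrite mulr1 -exprS -addn1 -cardF; exact: expf_card.
by have [i ->] := prim_rootP gP x1; exists i.
Qed.

Lemma index6X i : index6 (g ^+ i) = (i %% 6)%N.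
Proof.
rewrite /index6; case: pickP => [j /eqP|].
  move/eqP; rewrite (eq_prim_root_expr gP) => /eqP E.
  have d6 : (6 %| 18 * n)%N by lia.
  by have := congr1 (modn^~ 6) E; rewrite /= !modn_dvdm.
have m : (i %% (18 * n) < 18 * n)%N by rewrite ltn_mod (prim_order_gt0 gP).
by move/(_ (Ordinal m)); rewrite /= prim_expr_mod ?eqxx.
Qed.

Lemma index6_lt6 x : (index6 x < 6)%N.
Proof. by rewrite /index6; case: pickP => // i _; rewrite ltn_mod. Qed.

Lemma index6M x y : x != 0 -> y != 0 -> index6 (x * y) = ((index6 x + index6 y) %% 6)%N.
Proof.
move=> /log_exists[i _ ->] /log_exists[j _ ->].
by rewrite -exprD !index6X modnDm.
Qed.

Lemma index6_1 : index6 1 = 0%N. Proof. by rewrite -(expr0 g) index6X. Qed.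

Lemma index6V x : x != 0 -> ((index6 x^-1 + index6 x) %% 6 = 0)%N.
Proof. by move=> x0; rewrite -index6M ?invr_eq0 // mulVf // index6_1. Qed.

(** [-1] is [g ^+ (9 * n)], and 9n is 3 modulo 6 for odd [n]. *)
Lemma index6N1 : odd n -> index6 (-1) = 3%N.
Proof.
move=> on; suff <- : g ^+ (9 * n) = -1 by rewrite index6X; lia.
have : (g ^+ (9 * n)) ^+ 2 == 1.
  by rewrite -exprM (_ : 9 * n * 2 = 18 * n)%N ?prim_expr_order //; lia.
rewrite sqrf_eq1 => /orP[|/eqP //].
rewrite -(prim_order_dvd gP) => /dvdn_leq.
by have := n_gt0; lia.
Qed.

Lemma index6_eq0 x : x != 0 -> index6 x = 0%N -> exists2 i, (i < 3 * n)%N & x = g ^+ (6 * i).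
Proof.
move=> /log_exists[i lti ->]; rewrite index6X => i6.
by exists (i %/ 6)%N; [lia | congr (_ ^+ _); lia].
Qed.

(* The real character [chi + conj chi], where [chi] is a cubic character. *)
Definition cub (x : F) : int :=
  if x == 0 then 0 else if (index6 x %% 3 == 0)%N then 2 else -1.

Lemma cub0 : cub 0 = 0. Proof. by rewrite /cub eqxx. Qed.
Lemma cubN0 x : x != 0 -> cub x = if (index6 x %% 3 == 0)%N then 2 else -1.
Proof. by rewrite /cub => /negbTE->. Qed.

(** Expand (chi + conj chi)(x) (chi + conj chi)(y) using conj chi(y) = chi(1/y); the convention 1/0
    = 0 keeps this true at zero. *)
Lemma cubM x y : cub x * cub y = cub (x * y) + cub (x / y).
Proof.
have [->|x0] := eqVneq x 0; first by rewrite !mul0r cub0 mul0r addr0.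
have [->|y0] := eqVneq y 0; first by rewrite invr0 !mulr0 cub0 mulr0 addr0.
have V := index6V y0; have x6 := index6_lt6 x; have y6 := index6_lt6 y;
  have v6 := index6_lt6 y^-1.
rewrite !cubN0 ?mulf_neq0 ?invr_eq0 // !index6M ?invr_eq0 // !modn_dvdm //.
by do ![case: eqP] => *; lia.
Qed.

Lemma cub_cube x y : x != 0 -> (index6 x %% 3 = 0)%N -> cub (x * y) = cub y.
Proof.
move=> x0 x3; have [->|y0] := eqVneq y 0; first by rewrite mulr0.
rewrite !cubN0 ?mulf_neq0 // index6M // modn_dvdm // -modnDm x3 add0n modn_mod //.
Qed.

Lemma sum_scale c (h : F -> int) : c != 0 -> \sum_x h (c * x) = \sum_x h x.
Proof.
move=> c0; rewrite [RHS](reindex (fun x => c * x)) //.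
by exists (fun x => c^-1 * x) => x _; rewrite ?mulKf ?mulVKf.
Qed.

Lemma sum_shift c (h : F -> int) : \sum_x h (x + c) = \sum_x h x.
Proof.
rewrite [RHS](reindex (fun x => x + c)) //.
by exists (fun x => x - c) => x _; rewrite ?addrK ?subrK.
Qed.

(** The three cube roots of unity sum to 0; the vanishing sums below rest on this averaging over 1,
    g, g^2. *)
Lemma cub_g x : cub x + cub (g * x) + cub (g ^+ 2 * x) = 0.
Proof.
have [->|x0] := eqVneq x 0; first by rewrite !mulr0 cub0.
rewrite !cubN0 ?mulf_neq0 ?expf_neq0 ?g_neq0 // !index6M ?expf_neq0 ?g_neq0 //.
have := index6X 1; rewrite expr1 => ->.
by do ![case: eqP] => *; lia.
Qed.

Lemma sum_cub : \sum_x cub x = 0.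
Proof.
have : \sum_x (cub x + cub (g * x) + cub (g ^+ 2 * x)) = 0 by apply: big1 => x _; exact: cub_g.
rewrite !big_split /= !sum_scale ?expf_neq0 ?g_neq0 //.
by move: (\sum_x cub x) => S; lia.
Qed.

Lemma sum_cub_scale x : x != 0 -> \sum_c cub (c * x) = 0.
Proof.
by move=> x0; under eq_bigr do rewrite mulrC; rewrite sum_scale // sum_cub.
Qed.

Lemma cub1 : cub 1 = 2.
Proof. by rewrite cubN0 ?oner_eq0 // index6_1. Qed.

(* [(u - t) / (v - t)] takes every value except [1] once. *)
Lemma sum_cub_moebius c u v : u != v -> \sum_t cub (c * ((u - t) / (v - t))) = - cub c.
Proof.
move=> uv; have d0 : u - v != 0 by rewrite subr_eq0.
(* The value at the pole is the one that [1 + (u - v) / t] misses, so [f] permutes the field. *)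
pose f t := if t == 0 then 1 else 1 + (u - v) / t.
have f_inj : injective f.
  move=> x y; rewrite /f; case: eqVneq => [->|x0]; case: eqVneq => [->|y0] //.
  - by move/esym/eqP; rewrite -subr_eq0 addrC addKr mulf_eq0 (negbTE d0) invr_eq0 (negbTE y0).
  - by move/eqP; rewrite -subr_eq0 addrC addKr mulf_eq0 (negbTE d0) invr_eq0 (negbTE x0).
  by move/addrI/(mulfI d0)/invr_inj.
have : \sum_t cub (c * f t) = \sum_t cub (c * t).
  by rewrite [RHS](reindex f) //; apply: onW_bij; apply: injF_bij.
have -> : \sum_t cub (c * t) = 0.
  have [->|c0] := eqVneq c 0; first by apply: big1 => t _; rewrite mul0r cub0.
  by rewrite sum_scale // sum_cub.
rewrite (bigD1 0) //= {1}/f eqxx mulr1 => /eqP; rewrite addrC addr_eq0 => /eqP <-.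
rewrite -(sum_shift v) -[in LHS](@sum_scale (-1)) ?oppr_eq0 ?oner_eq0 //.
rewrite (bigD1 0) //= mulr0 add0r subrr invr0 !mulr0 cub0 add0r.
apply: eq_bigr => t t0; rewrite /f (negbTE t0); congr (cub (c * _)).
by field.
Qed.

(** For [t != 0], substituting u = t y shows this to be twice the real part of chi(t)^2 J(chi, chi),
    with J the Jacobi sum. *)
Definition jac t := \sum_u cub (u * (u - t)).

Lemma jac_scale c t : c != 0 -> (index6 c %% 3 = 0)%N -> jac (c * t) = jac t.
Proof.
move=> c0 c3; rewrite /jac -(@sum_scale c) //; apply: eq_bigr => u _.
by rewrite -mulrBr mulrACA cub_cube ?mulf_neq0 // index6M // ; lia.
Qed.

(** Here [18 * n] is q - 1. By [cubM] the square splits into two double sums; summed over [t], the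
    first vanishes by homogeneity and the second is evaluated by [sum_cub_moebius]. *)
Lemma jac_energy : \sum_t jac t ^+ 2 = 2 * (18 * n)%:Z * (18 * n).+1%:Z.
Proof.
have E t : jac t ^+ 2 = \sum_u \sum_v (cub (u * v * (u - t) * (v - t)) + cub (u / v * ((u -
  t) / (v - t)))).
  rewrite expr2 /jac mulr_suml; apply: eq_bigr => u _; rewrite mulr_sumr;
    apply: eq_bigr => v _.
  rewrite cubM; congr (cub _ + cub _); first by ring.
  by rewrite invfM; ring.
under eq_bigr do rewrite E.
under eq_bigr do under eq_bigr do rewrite big_split.
under eq_bigr do rewrite big_split.
rewrite big_split /=.
have -> : \sum_i \sum_i0 \sum_i1 cub (i0 * i1 * (i0 - i) * (i1 - i)) = 0.
  set T := LHS.
  (* The argument has degree 4 and c^4 has the cubic class of c, so scaling all three variables by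
     [c] amounts to one factor [c]. *)
  have Tc c : c != 0 -> T = \sum_t \sum_u \sum_v cub (c * (u * v * (u - t) * (v - t))).
    move=> c0; rewrite /T -(sum_scale _ c0); apply: eq_bigr => t _.
    rewrite -(sum_scale _ c0); apply: eq_bigr => u _.
    rewrite -(sum_scale _ c0); apply: eq_bigr => v _.
    rewrite -!mulrBr -[RHS](@cub_cube (c ^+ 3)) ?expf_neq0 //; first by congr cub; ring.
    by rewrite !exprS expr0 mulr1 !index6M ?mulf_neq0 //; lia.
  have g0 := g_neq0; have g2 : g ^+ 2 != 0 by rewrite expf_neq0.
  suff: T + T + T = 0 by lia.
  rewrite {2}(Tc _ g0) {2}(Tc _ g2) /T -!big_split /=; apply: big1 => t _.
  rewrite -!big_split /=; apply: big1 => u _.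
  by rewrite -!big_split /=; apply: big1 => v _; exact: cub_g.
rewrite add0r exchange_big /=; under eq_bigr do rewrite exchange_big /=.
have D u v : \sum_t cub (u / v * ((u - t) / (v - t))) =
   if u == v then (if u == 0 then 0 else 2 * (18 * n)%:Z) else - cub (u / v).
  case: eqVneq => [->|uv]; last by rewrite sum_cub_moebius.
  have [->|v0] := eqVneq v 0.
    by apply: big1 => t _; rewrite mul0r mul0r cub0.
  rewrite (bigD1 v) //= subrr mul0r mulr0 cub0 add0r divff //.
  under eq_bigr => t tv do rewrite divff ?subr_eq0 1?eq_sym // mulr1 cub1.
  rewrite sumr_const -[LHS]mulr_natr; congr (_ * _); rewrite natz; congr Posz.
  by have := cardC1 v; rewrite cardF addn1 /= => <-; apply: eq_card.
under eq_bigr do under eq_bigr do rewrite D.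
(* The off-diagonal terms complete to a vanishing sum and contribute [cub 1 = 2], turning 2(q - 1)
   into 2q. *)
have R u : \sum_v (if u == v then if u == 0 then 0 else 2 * (18 * n)%:Z else - cub (u / v))
    = if u == 0 then 0 else 2 * (18 * n).+1%:Z.
  have [->|u0] := eqVneq u 0.
    by apply: big1 => v _; rewrite mul0r cub0 oppr0 if_same.
  rewrite (bigD1 u) //= eqxx.
  under eq_bigr => v vu do rewrite eq_sym (negbTE vu).
  have : \sum_v cub (u / v) = 0.
    by rewrite (reindex_inj invr_inj) /=; under eq_bigr do rewrite invrK mulrC;
      exact: sum_cub_scale.
  rewrite (bigD1 u) //= divff // cub1 sumrN.
  by move: (\sum_(i | _) _) => S; lia.
under eq_bigr do rewrite R.
rewrite (bigD1 0) //= eqxx add0r; under eq_bigr => u u0 do rewrite (negbTE u0).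
rewrite sumr_const -[LHS]mulr_natr (_ : #|_| = (18 * n)%N); first by rewrite natz; lia.
by have := cardC1 (0 : F); rewrite cardF addn1 /= => <-; apply: eq_card.
Qed.

(** [jac] is constant on the cubic class of [t], so (q - 1)/3 equal squares are bounded by the total
    2q(q - 1). The weight [1 + cub (s / t)] is 3 on that class and 0 on the other two. *)
Lemma jac_bound t : t != 0 -> jac t ^+ 2 <= 6 * (18 * n).+1%:Z.
Proof.
move=> t0.
have B s : (if s == 0 then 0 else 1 + cub (s / t)) * jac t ^+ 2 <= 3 * jac s ^+ 2.
  have [->|s0] := eqVneq s 0; first by rewrite mul0r mulr_ge0 ?sqr_ge0.
  rewrite cubN0 ?mulf_neq0 ?invr_eq0 //; case: eqP => st.
    by rewrite -(divfK t0 s) jac_scale ?mulf_neq0 ?invr_eq0 ?divfK //; lra.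
  by rewrite addrN mul0r mulr_ge0 ?sqr_ge0.
have : \sum_s (if s == 0 then 0 else 1 + cub (s / t)) * jac t ^+ 2 <= \sum_s 3 * jac s ^+ 2.
  exact: ler_sum.
rewrite -mulr_suml -mulr_sumr jac_energy.
suff -> : \sum_s (if s == 0 then 0 else 1 + cub (s / t)) = (18 * n)%:Z.
  by have := n_gt0; nia.
have : \sum_s (1 + cub (s / t)) = (18 * n).+1%:Z.
  rewrite big_split /= sum_cub_scale ?invr_eq0 // sumr_const cardF addr0 natz addn1.
  by [].
rewrite (bigD1 0) //= mul0r cub0 => E.
rewrite (bigD1 0) //= eqxx; under eq_bigr => s s0 do rewrite (negbTE s0).
move: E.
by move: (\sum_(i | _) _) => S; lia.
Qed.

(** * Counting elements with differences in distinct cubic classes *)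

Definition zeta3 := g ^+ (6 * n).

Lemma zeta3_neq0 : zeta3 != 0. Proof. by rewrite expf_neq0 ?g_neq0. Qed.

Lemma index6_zeta3 : index6 zeta3 = 0%N. Proof. by rewrite index6X; lia. Qed.

Lemma zeta3_prim : 3.-primitive_root zeta3.
Proof.
have := dvdn_prim_root gP (_ : 3 %| 18 * n)%N.
by rewrite (_ : 18 * n %/ 3 = 6 * n)%N; [apply; lia | lia].
Qed.

Lemma zeta3X3 : zeta3 ^+ 3 = 1. Proof. exact: prim_expr_order zeta3_prim. Qed.

Lemma zeta3_neq1 : zeta3 != 1.
Proof. by have := prim_order_dvd zeta3_prim 1; rewrite expr1 => <-. Qed.

Definition transversal3 (a b c : nat) :=
  [&& a %% 3 != b %% 3, b %% 3 != c %% 3 & a %% 3 != c %% 3]%N.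

(* For residues [a], [b], [c] modulo 3, [9] times the indicator of their being
   distinct is [2 + 2 h(a + b + c) - h(a - b) - h(b - c) - h(a - c)], where [h]
   is [2] at [0] and [-1] elsewhere; here [c = 0]. *)
Lemma transversal3_indicator a b b' : ((b' + b) %% 6 = 0)%N ->
  let h k : int := if (k %% 3 == 0)%N then 2 else -1 in
  9 * (transversal3 a b 0)%:Z = 2 + 2 * h (a + b)%N - h (a + b')%N - h b - h a.
Proof.
move=> bb' /=; have b3 : (b' %% 3 = (3 - b %% 3) %% 3)%N by lia.
rewrite /transversal3 -(modnDm a b) -(modnDm a b') b3.
move: (a %% 3)%N (b %% 3)%N (ltn_pmod a (isT : 0 < 3)%N) (ltn_pmod b (isT : 0 < 3)%N).
by case=> [|[|[|i]]] [|[|[|j]]].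
Qed.

(* Here [v = (w - 1) / (w - zeta3)], for which [(w - zeta3 ^ 2) / (w - zeta3)] is
   [- zeta3 * (v + zeta3)]. *)
Definition good v := [&& v != 0, v + zeta3 != 0
  & transversal3 (index6 v) (index6 (v + zeta3)) 0].

Lemma card_good (on : odd n) :
  (9 * #|[set v | good v]|)%:Z = 2 * (18 * n).+2%:Z + 2 * jac (- zeta3).
Proof.
have N0 : (-1 : F) != 0 by rewrite oppr_eq0 oner_eq0.
have cube : cub zeta3 = 2 by rewrite cubN0 ?zeta3_neq0 // index6_zeta3.
have cubNe : cub (- zeta3) = 2.
  by rewrite -mulN1r cub_cube // index6N1.
(* At the degenerate values [v = 0] and [v = - zeta3] the constant 2 is cancelled by [cub zeta3] and
   [cub (- zeta3)]. The quotient is written in the shape required by [sum_cub_moebius]. *)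
have I v : 9 * (good v)%:Z = 2 + 2 * cub (v * (v - - zeta3)) - cub (1 * ((0 - v) / (- zeta3 -
  v)))
   - cub (v + zeta3) - cub v.
  rewrite opprK mul1r sub0r -opprD (addrC zeta3) invrN mulrNN.
  have [->|v0] := eqVneq v 0; first by rewrite /good eqxx !mul0r add0r cub0 cube.
  rewrite /good v0 /=.
  have [/eqP|ve] := eqVneq (v + zeta3) 0.
    by rewrite addr_eq0 => /eqP ->; rewrite addNr invr0 !mulr0 cub0 cubNe.
  rewrite !cubN0 ?mulf_neq0 ?invr_eq0 // !index6M ?invr_eq0 // !modn_dvdm //.
  by apply: transversal3_indicator; apply: index6V.
have -> : (9 * #|[set v | good v]|)%:Z = \sum_v 9 * (good v)%:Z.
  rewrite -mulr_sumr PoszM; congr (_ * _).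
  rewrite -sum1_card -[LHS]natz natr_sum big_mkcond /=; apply: eq_bigr => v _.
  by rewrite inE; case: good.
under eq_bigr do rewrite I.
rewrite !big_split /= !sumrN.
rewrite sum_cub_moebius; last by rewrite eq_sym oppr_eq0 zeta3_neq0.
rewrite (@sum_shift zeta3 cub) sum_cub cub1 -mulr_sumr sumr_const cardF.
rewrite !natz -/(jac _); move: (jac _) => J.
lia.
Qed.

(** Otherwise [h], inverse to w -> (w - 1)/(w - zeta3), would inject the good [v] into the 3n - 3
    sixth powers outside the cube roots of unity. *)
Lemma exists_transversal_noncube6 (on : odd n) : exists w : F, [/\ w != 0, index6 w != 0%N,
  [/\ w != 1, w != zeta3 & w != zeta3 ^+ 2] &
  transversal3 (index6 (w - 1)) (index6 (w - zeta3)) (index6 (w - zeta3 ^+ 2))].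
Proof.
pose Q (w : F) := [&& w != 0, index6 w != 0%N, w != 1, w != zeta3, w != zeta3 ^+ 2 &
  transversal3 (index6 (w - 1)) (index6 (w - zeta3)) (index6 (w - zeta3 ^+ 2))].
case: (pickP Q) => [w /and5P[w0 w6 w1 we /andP[we2 wt]]|noQ]; first by exists w; split.
have e0 := zeta3_neq0; have e3 := zeta3X3.
have e1 : 1 - zeta3 != 0 by rewrite subr_eq0 eq_sym zeta3_neq1.
have N0 : (-1 : F) != 0 by rewrite oppr_eq0 oner_eq0.
have index6N1' := index6N1 on; have ce := index6_zeta3.
pose h v := (1 - zeta3 * v) / (1 - v).
pose C6 := [set g ^+ (6 * val i) | i : 'I_(3 * n)].
have cC6 : (#|C6| <= 3 * n)%N by rewrite -[X in (_ <= X)%N]card_ord leq_imset_card.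
have inC6 w : w != 0 -> index6 w = 0%N -> w \in C6.
  by move=> w0 /(index6_eq0 w0)[i li ->]; apply/imsetP; exists (Ordinal li).
have G v : good v -> [/\ 1 - v != 0, h v - 1 = v * (1 - zeta3) / (1 - v),
    h v - zeta3 = (1 - zeta3) / (1 - v) &
    h v - zeta3 ^+ 2 = - 1 * (zeta3 * (v + zeta3)) * (1 - zeta3) / (1 - v)].
  move=> /and3P[v0 ve tv]; have v1 : 1 - v != 0.
    rewrite subr_eq0; apply: contraTneq tv => <-.
    by rewrite index6_1 /transversal3 andbC eqxx !andbF.
  split; rewrite // /h; [by field | by field |].
  apply: (mulIf v1); rewrite mulrBl !divfK //.
  transitivity (- 1 * (zeta3 * (v + zeta3)) * (1 - zeta3) + (1 - zeta3 ^+ 3)).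
    by move: zeta3 => e; ring.
  by rewrite e3 subrr addr0.
have H v : good v -> [/\ h v \in C6, h v != 1, h v != zeta3 & h v != zeta3 ^+ 2].
  move=> gv; have [v1 E1 E2 E3] := G v gv; have /and3P[v0 ve tv] := gv.
  have c0 : (1 - zeta3) / (1 - v) != 0 by rewrite mulf_neq0 ?invr_eq0.
  rewrite -!(subr_eq0 (h v)) E1 E2 E3 -!mulrA !mulf_neq0 ?invr_eq0 //.
  split=> //; have h0 : h v != 0.
    rewrite mulf_neq0 ?invr_eq0 // subr_eq0; apply: contraTneq tv => /(congr1 index6).
    rewrite index6_1 index6M // ce add0n => Ev; have := index6_lt6 v.
    by rewrite /transversal3 -[index6 v](@modn_small _ 6) ?index6_lt6 // -Ev eqxx !andbF.
  apply: inC6 => //; apply/eqP; apply: contraFT (noQ (h v)) => h6.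
  rewrite /Q h0 h6 -!(subr_eq0 (h v)) E1 E2 E3 -!mulrA !mulf_neq0 ?invr_eq0 //=.
  (* The common factor (1 - zeta3)/(1 - v) shifts the three classes equally, and -1 and zeta3 are
     cubes. *)
  rewrite !index6M ?mulf_neq0 ?invr_eq0 // index6N1' ce.
  move: tv; rewrite /transversal3.
  move: (index6 v) (index6 (v + zeta3)) (index6 (1 - zeta3)) (index6 _^-1) => a b c d; clear;
    lia.
have h_inj : {in [set v | good v] &, injective h}.
  move=> u v; rewrite !inE => /G[u1 _ Eu _] /G[v1 _ Ev _] huv.
  move: Eu; rewrite huv Ev => /(mulfI e1)/invr_inj/addrI/oppr_inj.
  by move->.
pose U := [set 1; zeta3; zeta3 ^+ 2].
have cU : #|U| = 3.
  have E i j : (zeta3 ^+ i == zeta3 ^+ j) = (i == j %[mod 3])%N by rewrite (eq_prim_root_expr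
    zeta3_prim).
  have := (E 0%N 1%N, E 0%N 2, E 1%N 2); rewrite expr0 expr1 => -[[E1 E2] E3].
  by rewrite /U -setUA cardsU1 cards2 !inE E1 E2 E3.
have sub : U :|: h @: [set v | good v] \subset C6.
  apply/subsetP => w; rewrite !inE => /orP[|/imsetP[v]]; last by rewrite inE => /H[? _ _ _] ->.
  case/orP=> [/orP[]|] /eqP->; apply: inC6; rewrite ?oner_eq0 ?index6_1 ?(expf_neq0 2 e0) //.
  by rewrite expr2 index6M // ce.
have dis : [disjoint U & h @: [set v | good v]].
  apply/pred0P => w /=; apply/negP => /andP[wU /imsetP[v]]; rewrite inE => /H[_ h1 h2 h3] E.
  by move: wU; rewrite E !inE (negbTE h1) (negbTE h2) (negbTE h3).
have := leq_trans (subset_leq_card sub) cC6.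
rewrite cardsU disjoint_setI0 // cards0 subn0 cU card_in_imset //.
have := jac_bound (_ : - zeta3 != 0); rewrite oppr_eq0 => /(_ e0).
have := card_good on.
(* Together these force 2J <= -(9n + 31), against J^2 <= 6(18n + 1). *)
move: (jac _) #|_| => J N; nia.
Qed.

End Cyclotomy.

(** * Blocks from six coset representatives *)

Definition starter_family (F : finFieldType) (n : nat) : Prop :=
  exists P : {set {set 'Z_3 * F}},
    is_PDF (nseq (12 * n + 1) 3 ++ nseq (3 * n) 6) 3 P /\
    is_base_parallel_class_HS [:: 3; 6] (3 * #|F|) P.

Section Blocks.
Local Open Scope ring_scope.
Import GRing.Theory.
Variables (F : finFieldType) (n : nat) (g : F).
Hypotheses (cardF : #|F| = (18 * n + 1)%N) (gP : (18 * n).-primitive_root g).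
Variables (t : 'I_6 -> F) (shift : 'I_6 -> 'Z_3) (s : nat -> 'Z_3).
Let cls := @index6 F n g.
Let eps := @zeta3 F n g.
Hypothesis t_neq0 : forall r, t r != 0.
Hypothesis cls_t_inj : injective (fun r => cls (t r)).
(** There are 8 pairs [(r, r')] in a common base block, hence 8 * 3 - 6 = 18 nontrivial triples
    [(r, r', j)] for the 18 pairs [(c, k)]: existence alone will force uniqueness. *)
Hypothesis cover_diffs : forall (c : 'Z_3) (k : nat), (k < 6)%N ->
  exists r r' : 'I_6, exists j : 'Z_3,
    [/\ r.-1 = r'.-1, shift r' - shift r + s r.-1 * j = c,
        t r' * eps ^+ j - t r != 0 & cls (t r' * eps ^+ j - t r) = k].

(* [(r, (i, m))] stands for the element [t r * g ^ (6 i) * eps ^ m] of the class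
   of [t r]; the layer of a point moves by [s] along its [eps]-orbit.  The
   predecessor of [r] indexes the base blocks, so that the classes of [t 0] and
   [t 1] make up the hexad. *)
Let X := ('I_6 * ('I_n * 'Z_3))%type.

Definition point (x : X) : F := t x.1 * (g ^+ (6 * x.2.1) * eps ^+ x.2.2).
Definition block_index (x : X) : nat * 'I_n := (x.1.-1, x.2.1).
Definition layer (x : X) : 'Z_3 := shift x.1 + s x.1.-1 * x.2.2.

Lemma epsD (i j : 'Z_3) : eps ^+ (i + j)%R = eps ^+ i * eps ^+ j.
Proof. by rewrite -exprD /= (prim_expr_mod (zeta3_prim cardF gP)). Qed.

Lemma point_neq0 x : point x != 0.
Proof. by rewrite !mulf_neq0 ?t_neq0 ?expf_neq0 ?(g_neq0 gP) ?(zeta3_neq0 gP). Qed.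

Lemma point_inj : injective point.
Proof.
have g0 := g_neq0 gP.
have E x : point x = t x.1 * g ^+ (6 * (x.2.1 + n * x.2.2)).
  by rewrite /point /eps /zeta3 -exprM -exprD; congr (_ * _ ^+ _); lia.
move=> [r [i m]] [r' [i' m']]; rewrite !E /= => pp.
have rr : r = r'.
  apply: cls_t_inj; have := congr1 cls pp.
  rewrite /cls !(index6M cardF gP) ?expf_neq0 //; rewrite !(index6X cardF gP).
  have := index6_lt6 n g (t r); have := index6_lt6 n g (t r').
  by move: (index6 _ _ _) (index6 _ _ _) => a b; lia.
move: pp; rewrite -rr => /(mulfI (t_neq0 r))/eqP; rewrite (eq_prim_root_expr gP).
have := ltn_ord i; have := ltn_ord i'; have := ltn_ord m : (m < 3)%N;
  have := ltn_ord m' : (m' < 3)%N.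
move=> m3' m3 lti' lti; rewrite !modn_small => [/eqP eq||]; [|nia|nia].
have im : (m : nat) = m' by nia.
by congr (_, (_, _)); [apply: val_inj; rewrite /=; nia | apply: val_inj].
Qed.

Lemma cardX : #|{: X}| = (18 * n)%N.
Proof. by rewrite !card_prod !card_ord -[(Zp_trunc 3).+2]/3%N; lia. Qed.

Definition opt_point (o : option X) : F := oapp point 0 o.

Lemma opt_point_bij : bijective opt_point.
Proof.
apply: inj_card_bij; last by rewrite card_option cardX cardF addn1.
move=> [x|] [y|] //= E; first by congr Some; apply: point_inj.
- by have := point_neq0 x; rewrite E eqxx.
- by have := point_neq0 y; rewrite -E eqxx.
Qed.

Lemma point_exists y : y != 0 -> exists x, y = point x.
Proof.
case: opt_point_bij => h _ hK y0; move: y0; rewrite -(hK y).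
by case: (h y) => [x _|]; [exists x | rewrite eqxx].
Qed.

Definition idx (y : F) : option X := [pick x | point x == y].

Lemma idx_point x : idx (point x) = Some x.
Proof.
rewrite /idx; case: pickP => [x' /eqP/point_inj->//|/(_ x)]; by rewrite eqxx.
Qed.

Lemma idx0 : idx 0 = None.
Proof. by rewrite /idx; case: pickP => // x; rewrite (negbTE (point_neq0 x)). Qed.

Definition block_pairs : {set X * X} :=
  [set p | (p.1 != p.2) && (block_index p.1 == block_index p.2)].

Lemma card_pred_pairs : #|[set p : 'I_6 * 'I_6 | p.1.-1 == p.2.-1]| = 8.
Proof.
rewrite -sum1_card big_mkcond /=.
rewrite (eq_bigr (fun p : 'I_6 * 'I_6 => nat_of_bool (p.1.-1 == p.2.-1))) => [|p _];
  last by rewrite inE; case: eqP.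
rewrite -(pair_bigA _ (fun i j : 'I_6 => nat_of_bool (i.-1 == j.-1))) /=.
by rewrite !big_ord_recl !big_ord0.
Qed.

Lemma card_block_pairs : (#|block_pairs| <= 54 * n)%N.
Proof.
pose Y := [set p : 'I_6 * 'I_6 | p.1.-1 == p.2.-1].
pose h (q : ('I_6 * 'I_6) * ('I_n * ('Z_3 * 'Z_3))) : X * X :=
  ((q.1.1, (q.2.1, q.2.2.1)), (q.1.2, (q.2.1, q.2.2.2))).
pose dg := [set (x, x) | x : X].
have cdg : #|dg| = (18 * n)%N by rewrite card_imset ?cardX // => x y [].
have dis : [disjoint block_pairs & dg].
  by apply/pred0P => p /=; apply/negP => /andP[+ /imsetP[x _ E]]; rewrite E inE eqxx.
have sub : block_pairs :|: dg \subset h @: setX Y [set: 'I_n * ('Z_3 * 'Z_3)].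
  apply/subsetP => -[[r [i m]] [r' [i' m']]];
    rewrite !inE => /orP[/andP[_ /eqP[rr ii]]|/imsetP[[r0 [i0 m0]] _ [-> -> -> -> -> ->]]].
    by apply/imsetP; exists ((r, r'), (i, (m, m'))); rewrite ?inE /= ?rr ?eqxx // /h /= ii.
  by apply/imsetP; exists ((r0, r0), (i0, (m0, m0))); rewrite ?inE /= ?eqxx.
have := leq_trans (subset_leq_card sub) (leq_imset_card _ _).
rewrite cardsU disjoint_setI0 // cards0 cdg cardsX card_pred_pairs cardsT !card_prod
  !card_ord -[(Zp_trunc 3).+2]/3%N; lia.
Qed.

Definition pair_diff (p : X * X) : 'Z_3 * F := (layer p.1 - layer p.2, point p.1 - point p.2).

(** A base difference [D] in the class of [d] becomes [d] on multiplication by the sixth power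
    [d / D], which leaves the layer difference unchanged. *)
Lemma pair_diff_surj c d : d != 0 -> exists2 p, p \in block_pairs & pair_diff p = (c, d).
Proof.
move=> d0; have [r [r' [j [rr lc D0 Dk]]]] := cover_diffs c (index6_lt6 n g d).
set D := _ - _ in D0 Dk.
have h0 : d / D != 0 by rewrite mulf_neq0 ?invr_eq0.
have : index6 n g (d / D) = 0%N.
  rewrite (index6M cardF gP) ?invr_eq0 //; have := index6V cardF gP D0;
    rewrite -[index6 n g D]/(cls D) Dk; lia.
case/(index6_eq0 cardF gP h0) => u ltu Eh.
have n0 := n_gt0 gP.
have lti : (u %% n < n)%N by rewrite ltn_mod.
(* Writing [u < 3 n] as i + n m splits the sixth power into g^(6i) and a power of [eps]. *)
pose i := Ordinal lti; pose m : 'Z_3 := inZp (u %/ n).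
have hE : g ^+ (6 * i) * eps ^+ m = d / D.
  rewrite Eh /= /eps; set w := ((u %/ n) %% _)%N; have -> : w = (u %/ n)%N.
    by apply: modn_small; rewrite ltn_divLR.
  by rewrite /zeta3 -exprM -exprD; congr (_ ^+ _); nia.
pose x : X := (r, (i, m)); pose x' : X := (r', (i, m + j)).
have dE : point x' - point x = d.
  have -> : point x' = t r' * (g ^+ (6 * i) * eps ^+ (m + j)%R) by [].
  have -> : point x = t r * (g ^+ (6 * i) * eps ^+ m) by [].
  by rewrite epsD [g ^+ _ * _]mulrA hE; rewrite -[RHS](divfK D0) /D; ring.
exists (x', x).
  by rewrite inE /block_index /= rr eqxx andbT; apply: contraTneq d0 => E;
    rewrite -dE E subrr negbK eqxx.
by rewrite /pair_diff dE /layer /= -rr -lc; congr (_, _); ring.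
Qed.

(** At most 54n pairs are mapped onto 3(q - 1) = 54n differences. *)
Lemma pair_diff_inj : {in block_pairs &, injective pair_diff}.
Proof.
apply/imset_injP; rewrite eqn_leq leq_imset_card (leq_trans card_block_pairs) //.
have -> : (54 * n)%N = #|setX [set: 'Z_3] [set~ (0 : F)]|.
  by rewrite cardsX cardsT card_ord cardsC1 cardF -[(Zp_trunc 3).+2]/3%N; lia.
apply: subset_leq_card; apply/subsetP => -[c d];
  rewrite !inE /= => /(pair_diff_surj c)[p pD <-].
exact: imset_f.
Qed.

(* Fibres of [label] are the blocks; [None] is the label of [Z_3 x {0}], and the
   last component tells apart the three translates of a block. *)
Definition label (z : 'Z_3 * F) : option (nat * 'I_n * 'Z_3) :=
  omap (fun x => (block_index x, z.1 - layer x)) (idx z.2).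

Lemma label_point a x : label (a, point x) = Some (block_index x, a - layer x).
Proof. by rewrite /label idx_point. Qed.

Lemma label0 a : label (a, 0) = None.
Proof. by rewrite /label idx0. Qed.

Lemma eq_label_point a x a' x' :
  (label (a, point x) == label (a',
    point x')) = (block_index x == block_index x') && (a - layer x == a' - layer x').
Proof. by rewrite !label_point -xpair_eqE. Qed.

Lemma label_starter (p p' : 'Z_3 * F) : p != p' ->
  exists x0 : F, forall x : 'Z_3 * F, (label (p - x) == label (p' - x)) = (x.2 == x0).
Proof.
case: p p' => [a u] [a' u'] pp'.
(* Points with equal field coordinate share only a translate of [Z_3 x {0}]; for other points,
   [pair_diff] provides the unique pair inside a block with the given difference. *)
have [uu|uu] := eqVneq u u'.
  have aa : a != a' by apply: contra pp' => /eqP->; rewrite uu.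
  exists u => -[b y] /=; rewrite -uu.
  have -> : (a, u) - (b, y) = (a - b, u - y) by [].
  have -> : (a', u) - (b, y) = (a' - b, u - y) by [].
  have [->|yu] := eqVneq y u; first by rewrite subrr !label0 eqxx.
  have /point_exists[x ->] : u - y != 0 by rewrite subr_eq0 eq_sym.
  by rewrite eq_label_point eqxx /= !(inj_eq (addIr _)) (negbTE aa).
have d0 : u - u' != 0 by rewrite subr_eq0.
have [[x x'] xD E] := pair_diff_surj (a - a') d0.
exists (u - point x) => -[b y] /=.
have -> : (a, u) - (b, y) = (a - b, u - y) by [].
have -> : (a', u') - (b, y) = (a' - b, u' - y) by [].
apply/idP/eqP => [|->].
  have [uy|/point_exists[z Ez]] := eqVneq (u - y) 0.
    rewrite uy label0; have /point_exists[z' ->] : u' - y != 0.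
      by apply: contra uu => /eqP u'y; rewrite -(inj_eq (addIr (- y))) uy u'y.
    by rewrite label_point.
  have [u'y|/point_exists[z' Ez']] := eqVneq (u' - y) 0.
    by rewrite Ez u'y label0 label_point.
  rewrite Ez Ez' eq_label_point => /andP[bE /eqP mE].
  have zD : (z, z') \in block_pairs.
    rewrite inE /= bE andbT; apply: contraNneq uu => zz.
    by apply/eqP; apply: (addIr (- y)); rewrite Ez Ez' zz.
  have : pair_diff (z, z') = pair_diff (x, x').
    have /= lE := congr1 fst E; have /= dE := congr1 snd E.
    rewrite /pair_diff /= lE dE -Ez -Ez'; congr (_, _); last by ring.
    by rewrite -[layer z](subKr (a - b)) mE; ring.
  by move/(pair_diff_inj zD xD)/(congr1 fst) => /= <-; rewrite -Ez opprB addrC subrK.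
have /= lE := congr1 fst E; have /= dE := congr1 snd E.
have -> : u - (u - point x) = point x by ring.
have -> : u' - (u - point x) = point x'.
  by rewrite -[u'](subKr u) -dE; ring.
rewrite eq_label_point; move: xD; rewrite inE => /andP[_ ->] /=.
by rewrite -[a'](subKr a) -lE; apply/eqP; ring.
Qed.

Lemma card_fibre0 a : #|fibre label (a, 0)| = 3.
Proof.
rewrite -[RHS](card_ord 3) -cardsT -(card_imset _ (f := fun b : 'Z_3 => (b, 0 : F))).
  apply: eq_card => -[b y]; rewrite inE label0; apply/eqP/imsetP => [|[c _ [-> ->]]];
    last by rewrite label0.
  have [->|/point_exists[x ->]] := eqVneq y 0; first by exists b.
  by rewrite label_point.
by move=> b c [].
Qed.

Lemma card_fibre_point a x : #|fibre label (a, point x)| = if x.1.-1 == 0%N then 6 else 3.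
Proof.
pose h (q : 'I_6 * 'Z_3) : 'Z_3 * F :=
  let z := (q.1, (x.2.1, q.2)) in (a - layer x + layer z, point z).
have h_inj : injective h by move=> [r m] [r' m'] [_ /point_inj[-> ->]].
have -> : fibre label (a, point x) = h @: setX [set r : 'I_6 | r.-1 == x.1.-1] [set: 'Z_3].
  apply/setP => -[b y]; rewrite inE label_point; apply/eqP/imsetP.
    have [->|/point_exists[[r [i m]] ->]] := eqVneq y 0; first by rewrite label0.
    rewrite -label_point => /eqP; rewrite eq_label_point xpair_eqE /= =>
      /andP[/andP[/eqP rE /eqP iE] /eqP lE].
    exists (r, m); first by rewrite !inE /= rE eqxx.
    by rewrite /h /= iE lE subrK.
  move=> [[r m]]; rewrite !inE andbT /= => /eqP rE [-> ->].
  by rewrite label_point /block_index /= rE addrK.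
rewrite card_imset // cardsX cardsT card_ord -[(Zp_trunc 3).+2]/3%N.
suff -> : #|[set r : 'I_6 | r.-1 == x.1.-1]| = if x.1.-1 == 0%N then 2 else 1%N by case: ifP.
rewrite -sum1_card big_mkcond /= (eq_bigr (fun r : 'I_6 => nat_of_bool (r.-1 == x.1.-1))) =>
  [|r _].
  by rewrite !big_ord_recl big_ord0; case: x.1 => -[|[|[|[|[|[|]]]]]].
by rewrite inE; case: eqP.
Qed.

Lemma card_hexads : #|[set z | #|fibre label z| == 6]| = (6 * (3 * n))%N.
Proof.
pose h (q : 'Z_3 * X) : 'Z_3 * F := (q.1, point q.2).
have h_inj : injective h by move=> [a x] [b y] [-> /point_inj->].
have -> : [set z | #|fibre label z| == 6] = h @: setX [set: 'Z_3] (setX [set r : 'I_6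
  | r.-1 == 0%N] [set: 'I_n * 'Z_3]).
  apply/setP => -[a y]; rewrite inE; apply/idP/imsetP.
    have [->|/point_exists[x ->]] := eqVneq y 0; first by rewrite card_fibre0.
    by rewrite card_fibre_point; case: ifP => // x0 _; exists (a, x); rewrite ?inE ?x0.
  by move=> [[b x]]; rewrite !inE /= andbT => x0 [-> ->]; rewrite card_fibre_point x0.
rewrite card_imset // !cardsX !cardsT card_prod !card_ord -[(Zp_trunc 3).+2]/3%N.
suff -> : #|[set r : 'I_6 | r.-1 == 0%N]| = 2 by lia.
rewrite -sum1_card big_mkcond /= (eq_bigr (fun r : 'I_6 => nat_of_bool (r.-1 == 0%N))) =>
  [|r _].
  by rewrite !big_ord_recl big_ord0.
by rewrite inE; case: eqP.
Qed.

Lemma card_fibre_3_or_6 z : #|fibre label z| = 3 \/ #|fibre label z| = 6.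
Proof.
case: z => a y; have [->|/point_exists[x ->]] := eqVneq y 0; first by left;
  rewrite card_fibre0.
by rewrite card_fibre_point; case: ifP; [right | left].
Qed.

Lemma card_triples : #|[set z | #|fibre label z| == 3]| = (3 * (12 * n + 1))%N.
Proof.
have : #|~: [set z | #|fibre label z| == 6]| = #|[set z | #|fibre label z| == 3]|.
  by apply: eq_card => z; rewrite !inE; case: (card_fibre_3_or_6 z) => ->.
have := cardsC [set z | #|fibre label z| == 6].
by rewrite card_hexads card_prod card_ord cardF -[(Zp_trunc 3).+2]/3%N; lia.
Qed.

Lemma family_of_blocks : starter_family F n.
Proof.
exists (fibres label); split.
  split; first exact: fibres_partition.
    by apply: perm_fibres_size; rewrite ?card_triples ?card_hexads //;
      apply: card_fibre_3_or_6.
  by have := starter_Delta label_starter; rewrite card_ord.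
apply: starter_HS; first exact: label_starter.
- by move=> z; rewrite !inE; case: (card_fibre_3_or_6 z) => ->.
- move=> k; rewrite !inE => /orP[] /eqP->; first by exists (0, 0); rewrite card_fibre0.
  exists (0, point (ord0, (Ordinal (n_gt0 gP), 0))).
  by rewrite card_fibre_point.
- by move=> k; rewrite !inE => /orP[] /eqP->.
- by rewrite card_prod card_ord.
Qed.

End Blocks.

Section PrimitiveRoot.
Local Open Scope ring_scope.
Import GRing.Theory.

Lemma prim_root_exists (F : finFieldType) m : (0 < m)%N -> #|F| = m.+1 ->
  exists g : F, m.-primitive_root g.
Proof.
move=> m0 cF.
have /hasP[g _ gP] : has m.-primitive_root (enum [pred x : F | x != 0]); last by exists g.
apply: has_prim_root; rewrite ?enum_uniq //.
  apply/allP => x; rewrite mem_enum inE unity_rootE => x0.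
  by apply/eqP; apply: (mulfI x0); rewrite mulr1 -exprS -cF; exact: expf_card.
by rewrite -cardE; have := cardC1 (0 : F); rewrite cF /= => <-.
Qed.

End PrimitiveRoot.

(** * The two constructions *)

Section Constructions.
Local Open Scope ring_scope.
Import GRing.Theory.
Variables (F : finFieldType) (n : nat) (g : F).
Hypotheses (cardF : #|F| = (18 * n + 1)%N) (gP : (18 * n).-primitive_root g) (on : odd n).
Let cls := @index6 F n g.
Let eps := @zeta3 F n g.
Let theta := eps - 1.

Definition covers (t : 'I_6 -> F) (shift : 'I_6 -> 'Z_3) (s : nat -> 'Z_3)
    (c : 'Z_3) (k : nat) :=
  exists r r' : 'I_6, exists j : 'Z_3,
    [/\ r.-1 = r'.-1, shift r' - shift r + s r.-1 * j = c,
        t r' * eps ^+ j - t r != 0 & cls (t r' * eps ^+ j - t r) = k].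

Let clsMM x y : x != 0 -> y != 0 -> cls (x * y) = ((cls x + cls y) %% 6)%N
  := @index6M F n g cardF gP x y.
Let lt6 x : (cls x < 6)%N := index6_lt6 n g x.
Let e0 : eps != 0 := zeta3_neq0 gP.
Let ce : cls eps = 0%N := index6_zeta3 cardF gP.
Let e3 : eps ^+ 3 = 1 := zeta3X3 cardF gP.
Let g0 : g != 0 := g_neq0 gP.

Lemma theta_neq0 : theta != 0. Proof. by rewrite subr_eq0 (zeta3_neq1 cardF gP). Qed.
Let theta0 := theta_neq0.

Lemma cls_epsM x : x != 0 -> cls (eps * x) = cls x.
Proof. by move=> x0; rewrite clsMM // ce add0n modn_small. Qed.

Lemma cls_opp x : x != 0 -> cls (- x) = ((cls x + 3) %% 6)%N.
Proof.
move=> x0; rewrite -mulN1r clsMM ?oppr_eq0 ?oner_eq0 //.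
by rewrite [cls (-1)](index6N1 cardF gP on) addnC.
Qed.

Lemma eps2_sub1 : eps ^+ 2 - 1 = - (eps * (eps * theta)).
Proof.
apply/eqP; rewrite -subr_eq0 opprK; apply/eqP; transitivity (eps ^+ 3 - 1);
  last by rewrite e3 subrr.
by rewrite /theta; move: eps => e; ring.
Qed.

Section Covers.
Variables (t : 'I_6 -> F) (shift : 'I_6 -> 'Z_3) (s : nat -> 'Z_3).

Lemma coversI (r r' : 'I_6) (j : 'Z_3) c x k :
  r.-1 = r'.-1 -> shift r' - shift r + s r.-1 * j = c ->
  t r' * eps ^+ j - t r = x -> x != 0 -> cls x = k -> covers t shift s c k.
Proof. by move=> rr lc E x0 ck; exists r, r', j; rewrite E. Qed.

(** Exchanging the two points negates the difference, and -1 has class 3; the factor [eps ^+ (- j)]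
    restores the normal form. *)
Lemma covers_opp c k : covers t shift s c k -> covers t shift s (- c) ((k + 3) %% 6).
Proof.
move=> [r [r' [j [rr lc x0 ck]]]].
have ej0 (i : 'Z_3) : eps ^+ i != 0 by rewrite expf_neq0.
have cej (i : 'Z_3) : cls (eps ^+ i) = 0%N.
  elim: (i : nat) => [|i' IH]; first by rewrite expr0; exact: index6_1 cardF gP.
  by rewrite exprS cls_epsM ?expf_neq0.
pose x := t r' * eps ^+ j - t r.
apply: (@coversI r' r (- j) _ (- (eps ^+ (- j)%R * x))) => //.
- by rewrite -rr -lc; ring.
- have E : eps ^+ (- j)%R * eps ^+ j = 1 by rewrite -epsD // addNr expr0.
  by rewrite /x mulrBr mulrCA E; ring.
- by rewrite oppr_eq0 mulf_neq0.
by rewrite cls_opp ?mulf_neq0 // clsMM // cej ck; lia.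
Qed.

(** An orbit lying in one layer has differences in the classes of [t r * theta] and its opposite,
    which make up a whole cubic class. *)
Lemma covers_pure (r : 'I_6) k : s r.-1 = 0 -> t r != 0 -> (k < 6)%N ->
  (k %% 3 = (cls (t r * theta)%R) %% 3)%N -> covers t shift s 0 k.
Proof.
move=> sr tr k6 k3; have x0 : t r * theta != 0 by rewrite mulf_neq0.
have c6 := lt6 (t r * theta).
suff H1 : covers t shift s 0 (cls (t r * theta)).
  have [->|kE] : k = cls (t r * theta) \/ k = ((cls (t r * theta)%R + 3) %% 6)%N by lia.
    by [].
  by rewrite kE -[0]oppr0; apply: covers_opp.
apply: (@coversI r r 1 _ (t r * theta)) => //; first by rewrite sr; ring.
by rewrite /= expr1 /theta; ring.
Qed.

(* A triple [-x, -x eps, -x eps^2] placed on the three layers yields, over layer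
   difference 1, the class of [- x theta] or of [x theta] according to the direction
   of the twist; [M] is the set of classes already provided by the hexad. *)
Lemma covers_triple (M : pred nat) (r : 'I_6) x k : x != 0 -> t r = - x ->
  s r.-1 = (if M (cls (x * theta)) then 1 else - 1) ->
  (k < 6)%N -> (k %% 3 = (cls (x * theta)%R) %% 3)%N -> ~~ M k -> M ((k + 3) %% 6)%N ->
  covers t shift s 1 k.
Proof.
move=> x0 tr sr k6 k3 Mk Mk3; have xt0 : x * theta != 0 by rewrite mulf_neq0.
have c6 := lt6 (x * theta).
case Mx : (M (cls (x * theta))) sr => sr.
  apply: (@coversI r r 1 _ (- (x * theta))); rewrite ?oppr_eq0 //.
  - by rewrite sr; ring.
  - by rewrite tr /= expr1 /theta; ring.
  rewrite cls_opp //; have : k <> cls (x * theta) by move=> E; rewrite E Mx in Mk.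
  by clear -c6 k6 k3; lia.
apply: (@coversI r r (- 1) _ (eps * (eps * (x * theta)))); rewrite ?mulf_neq0 //.
- by rewrite sr; ring.
- have -> : eps ^+ (- 1 : 'Z_3)%R = eps ^+ 2 by [].
  have -> : t r * eps ^+ 2 - t r = - x * (eps ^+ 2 - 1) by rewrite tr; ring.
  by rewrite eps2_sub1; ring.
rewrite !cls_epsM ?mulf_neq0 //.
have : ((k + 3) %% 6)%N <> cls (x * theta) by move=> E; rewrite E Mx in Mk3.
by clear -c6 k6 k3; lia.
Qed.

Lemma family_of_covers : (forall r, t r != 0) -> injective (fun r => cls (t r)) ->
  (forall k, (k < 6)%N -> covers t shift s 0 k) ->
  (forall k, (k < 6)%N -> covers t shift s 1 k) ->
  starter_family F n.
Proof.
move=> t0 tinj h0 h1; apply: (family_of_blocks cardF gP t0 tinj (shift := shift) (s := s)).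
move=> c k k6; have : [\/ c = 0, c = 1 | c = - 1].
  by case: c => -[|[|[|//]]] i; [apply: Or31 | apply: Or32 | apply: Or33]; apply: val_inj.
case=> ->; [exact: h0 | exact: h1 |].
have -> : k = (((k + 3) %% 6 + 3) %% 6)%N by lia.
by apply: covers_opp; apply: h1; rewrite ltn_mod.
Qed.

End Covers.

Lemma nth6_neq0 (a : seq F) : size a = 6%N -> all (fun x => x != 0) a ->
  forall r : 'I_6, a`_r != 0.
Proof. by move=> sz /allP al r; apply: al; rewrite mem_nth // sz. Qed.

Lemma nth6_inj (a : seq F) : size a = 6%N -> uniq [seq cls x | x <- a] ->
  injective (fun r : 'I_6 => cls a`_r).
Proof.
move=> sz ua r r' /= E; apply/ord_inj/eqP.
rewrite -(nth_uniq 0%N _ _ ua) ?size_map ?sz //.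
by rewrite !(nth_map 0) ?sz //; apply/eqP.
Qed.

Definition z3nth (a : seq 'Z_3) (i : nat) : 'Z_3 := nth 0 a i.

Definition twist (M : pred nat) (x : F) : 'Z_3 := if M (cls (x * theta)) then 1 else - 1.

(** As [w] is not a cube, the orbits of 1, w, w^2 give all classes over layer difference 0. Over 1,
    the hexad gives one class in each cubic class and the twisted triples supply its opposite. *)
Lemma family_noncube w : w != 0 -> (cls w %% 3 != 0)%N ->
  [/\ w != 1, w != eps & w != eps ^+ 2] ->
  transversal3 (cls (w - 1)) (cls (w - eps)) (cls (w - eps ^+ 2)) ->
  starter_family F n.
Proof.
move=> w0 w3 [w1 we we2] tw.
have cw2 : cls (w ^+ 2) = ((cls w + cls w) %% 6)%N by rewrite expr2 clsMM.
pose M := [pred k | k \in [:: cls (w - 1); cls (w - eps); cls (w - eps ^+ 2)]].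
pose t := [:: 1; w; w ^+ 2; - 1; - w; - w ^+ 2].
(* The shift puts only the orbit of [w] on layer 1. The last list is indexed by base blocks: hexad,
   triple of w^2, three twisted triples. *)
apply: (@family_of_covers (fun r => t`_r) (z3nth [:: 0; 1])
  (z3nth [:: 0; 0; twist M 1; twist M w; twist M (w ^+ 2)])).
- by apply: nth6_neq0 => //=; rewrite !oppr_eq0 oner_eq0 w0 expf_neq0.
- apply: nth6_inj => //; rewrite /t /= !cls_opp ?oner_eq0 ?expf_neq0 // cw2 [cls 1](index6_1
  cardF gP).
  by move: (cls w) w3 (lt6 w) => [|[|[|[|[|[|]]]]]].
- move=> k k6; have : (k %% 3 = cls (1 * theta)%R %% 3 \/ k %% 3 = cls (w * theta)%R %% 3 \/
  k %% 3 = cls (w ^+ 2 * theta)%R %% 3)%N.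
    rewrite !clsMM ?oner_eq0 ?expf_neq0 // [cls 1](index6_1 cardF gP) !modn_dvdm //.
    by move: w3; clear; lia.
  case=> [|[|]] k3; [apply: (@covers_pure _ _ _ (inord 0))
    | apply: (@covers_pure _ _ _ (inord 1)) | apply: (@covers_pure _ _ _ (inord 2))];
    by rewrite ?inordK //= ?oner_eq0 ?expf_neq0.
move=> k k6; case Mk : (M k).
  move: Mk; rewrite !inE => /or3P[] /eqP->.
  - apply: (@coversI _ _ _ (inord 0) (inord 1) 0 _ (w - 1));
    rewrite ?subr_eq0 ?inordK //= ?subr0 ?mul0r ?addr0 //.
    by rewrite expr0 mulr1.
  - apply: (@coversI _ _ _ (inord 0) (inord 1) (-1) _ (eps * (eps * (w - eps))));
    rewrite ?mulf_neq0 ?subr_eq0 ?inordK //= ?subr0 ?mul0r ?addr0 //.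
      rewrite -[eps ^+ _]/(eps ^+ 2); transitivity (w * eps ^+ 2 - eps ^+ 3);
        first by rewrite e3.
      by move: eps => e; ring.
    by rewrite !cls_epsM ?mulf_neq0 ?subr_eq0.
  - apply: (@coversI _ _ _ (inord 0) (inord 1) 1 _ (eps * (w - eps ^+ 2)));
    rewrite ?mulf_neq0 ?subr_eq0 ?inordK //= ?subr0 ?mul0r ?addr0 //.
      transitivity (w * eps - eps ^+ 3); first by rewrite e3.
      by move: eps => e; ring.
    by rewrite !cls_epsM ?mulf_neq0 ?subr_eq0.
(* A transversal modulo 3 contains exactly one of each pair of opposite classes. *)
have Mk3 : M ((k + 3) %% 6)%N.
  move: Mk tw k6 (lt6 (w - 1)) (lt6 (w - eps)) (lt6 (w - eps ^+ 2));
    rewrite !inE /transversal3.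
  rewrite -/cls; move: (cls _) (cls _) (cls _) => a b c; clear; lia.
have : (k %% 3 = cls (1 * theta)%R %% 3 \/ k %% 3 = cls (w * theta)%R %% 3 \/
  k %% 3 = cls (w ^+ 2 * theta)%R %% 3)%N.
  rewrite !clsMM ?oner_eq0 ?expf_neq0 // [cls 1](index6_1 cardF gP) !modn_dvdm //.
  by move: w3; clear; lia.
case=> [|[|]] k3.
- by apply: (@covers_triple _ _ _ M (inord 3) 1); rewrite ?inordK ?Mk ?oner_eq0.
- by apply: (@covers_triple _ _ _ M (inord 4) w); rewrite ?inordK ?Mk.
- by apply: (@covers_triple _ _ _ M (inord 5) (w ^+ 2)); rewrite ?inordK ?Mk ?expf_neq0.
Qed.

(** Over layer difference 0 the hexad gives only the classes of w - 1 and 1 - w, which form the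
    cubic class of [theta]; the orbits of [g] and [g ^+ 2] give the rest. Over 1 it gives the four
    classes in [M]. *)
Lemma family_cls3 w : w != 0 -> cls w = 3%N ->
  [/\ w != 1, w != eps & w != eps ^+ 2] ->
  transversal3 (cls (w - 1)) (cls (w - eps)) (cls (w - eps ^+ 2)) ->
  (cls (w - 1)%R %% 3 = cls theta %% 3)%N ->
  starter_family F n.
Proof.
move=> w0 cw [w1 we we2] tw wth.
have cg : cls g = 1%N by rewrite -[X in cls X]expr1; exact: index6X cardF gP 1%N.
have cg2 : cls (g ^+ 2) = 2%N by exact: index6X cardF gP 2%N.
have g20 : g ^+ 2 != 0 by rewrite expf_neq0.
pose M := [pred k | k \in [:: cls theta; cls (w * theta); cls (w - eps ^+ 2);
  cls (- (w - eps))]].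
pose t := [:: 1; w; g; g ^+ 2; - g; - g ^+ 2].
apply: (@family_of_covers (fun r => t`_r) (fun=> 0)
  (z3nth [:: 1; 0; 0; twist M g; twist M (g ^+ 2)])).
- by apply: nth6_neq0 => //=; rewrite !oppr_eq0 oner_eq0 w0 g0 g20.
- by apply: nth6_inj => //; rewrite /t /= !cls_opp // cg cg2 cw [cls 1](index6_1 cardF gP).
- have H : covers (fun r => t`_r) (fun=> 0) (z3nth [:: 1; 0; 0; twist M g;
  twist M (g ^+ 2)]) 0 (cls (w - 1)).
    apply: (@coversI _ _ _ (inord 0) (inord 1) 0 _ (w - 1));
      rewrite ?subr_eq0 ?inordK //= ?subr0 ?mulr0 ?addr0 //.
    by rewrite expr0 mulr1.
  move=> k k6.
  have : [\/ k = cls (w - 1) \/ k = ((cls (w - 1)%R + 3) %% 6)%N,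
    (k %% 3 = cls (g * theta)%R %% 3)%N
    | (k %% 3 = cls (g ^+ 2 * theta)%R %% 3)%N].
    have : [\/ (k %% 3 = cls theta %% 3)%N, (k %% 3 = cls (g * theta)%R %% 3)%N
    | (k %% 3 = cls (g ^+ 2 * theta)%R %% 3)%N].
      rewrite [cls (g ^+ 2 * theta)]clsMM // cg2 [cls (g * theta)]clsMM // cg !modn_dvdm //.
      have : ((k %% 3 = cls theta %% 3) \/ (k %% 3 = (1 + cls theta) %% 3) \/
        k %% 3 = (2 + cls theta) %% 3)%N by clear; lia.
      by case=> [|[|]]; [apply: Or31 | apply: Or32 | apply: Or33].
    case=> [k3|k3|k3]; [apply: Or31 | by apply: Or32 | by apply: Or33].
    by move: (lt6 (w - 1)); rewrite -wth in k3; clear -k6 k3; lia.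
  case=> [[->|->]|k3|k3].
  + by [].
  + by have := covers_opp H; rewrite oppr0.
  + by apply: (@covers_pure _ _ _ (inord 2)); rewrite ?inordK.
  + by apply: (@covers_pure _ _ _ (inord 3)); rewrite ?inordK.
move=> k k6; case Mk : (M k).
  move: Mk; rewrite !inE => /or4P[] /eqP->.
  - apply: (@coversI _ _ _ (inord 0) (inord 0) 1 _ theta);
    rewrite ?inordK //= ?subrr ?mulr1 ?add0r //.
    by rewrite mul1r.
  - apply: (@coversI _ _ _ (inord 1) (inord 1) 1 _ (w * theta));
    rewrite ?mulf_neq0 ?inordK //= ?subrr ?mulr1 ?add0r //.
    by rewrite mulrBr mulr1.
  - apply: (@coversI _ _ _ (inord 0) (inord 1) 1 _ (eps * (w - eps ^+ 2)));
    rewrite ?mulf_neq0 ?subr_eq0 ?inordK //= ?subrr ?mulr1 ?add0r //.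
      transitivity (w * eps - eps ^+ 3); first by rewrite e3.
      by move: eps => e; ring.
    by rewrite cls_epsM ?subr_eq0.
  - apply: (@coversI _ _ _ (inord 1) (inord 0) 1 _ (- (w - eps)));
    rewrite ?oppr_eq0 ?subr_eq0 ?inordK //= ?subrr ?mulr1 ?add0r //.
    by rewrite opprB mul1r.
(* As [w] has class 3, [theta] and [w * theta] exhaust their cubic class; w - eps and w - eps^2 give
   one class in each of the other two. *)
have M36 : M ((k + 3) %% 6)%N /\ (k %% 3 <> cls theta %% 3)%N.
  move: Mk tw wth k6 (lt6 theta) (lt6 (w - 1)) (lt6 (w - eps)) (lt6 (w - eps ^+ 2)).
  rewrite !inE cls_opp ?subr_eq0 // clsMM // cw /transversal3 -!/cls.
  move: (cls _) (cls _) (cls _) (cls _) => a b c d; clear; lia.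
case: M36 => Mk3 kth.
have : (k %% 3 = cls (g * theta)%R %% 3 \/ k %% 3 = cls (g ^+ 2 * theta)%R %% 3)%N.
  rewrite [cls (g ^+ 2 * theta)]clsMM // cg2 [cls (g * theta)]clsMM // cg !modn_dvdm //.
  by clear -kth; lia.
case=> k3.
- by apply: (@covers_triple _ _ _ M (inord 4) g); rewrite ?inordK ?Mk.
- by apply: (@covers_triple _ _ _ M (inord 5) (g ^+ 2)); rewrite ?inordK ?Mk.
Qed.

Lemma starter_family_exists : starter_family F n.
Proof.
have [w [w0 cw [w1 we we2] tw]] := exists_transversal_noncube6 cardF gP on.
have [w3|w3] := boolP (cls w %% 3 == 0)%N; last exact: (family_noncube w0).
have {cw w3} cw : cls w = 3%N.
  by move: cw w3 (lt6 w); rewrite -/cls; move: (cls w) => a; clear; lia.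
pose Q x := [/\ x != 0, cls x = 3%N, [/\ x != 1, x != eps & x != eps ^+ 2] &
  transversal3 (cls (x - 1)) (cls (x - eps)) (cls (x - eps ^+ 2))].
(* Multiplication by [eps] permutes the three differences cyclically up to factors [eps], so one of
   three rotations brings the cubic class of [theta] to w - 1. *)
have rot x : Q x -> Q (eps * x) /\ cls (eps * x - 1) = cls (x - eps ^+ 2) /\
    cls (eps * x - eps ^+ 2) = cls (x - eps).
  case=> x0 cx [x1 xe xe2] tx.
  have E1 : eps * x - 1 = eps * (x - eps ^+ 2).
    by transitivity (eps * x - eps ^+ 3); [rewrite e3 | move: eps => e; ring].
  have E2 : eps * x - eps = eps * (x - 1) by ring.
  have E3 : eps * x - eps ^+ 2 = eps * (x - eps) by ring.
  rewrite /Q -!(subr_eq0 (eps * x)) E1 E2 E3 !cls_epsM ?subr_eq0 // !mulf_neq0 ?subr_eq0 //.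
  by split=> //; split=> //; move: tx; rewrite /transversal3; clear; lia.
have Qw : Q w by [].
have [Q1 [E1 E1']] := rot _ Qw; have [Q2 [E2 _]] := rot _ Q1.
have : [\/ (cls (w - 1)%R %% 3 = cls theta %% 3)%N,
  (cls (w - eps ^+ 2)%R %% 3 = cls theta %% 3)%N |
  (cls (w - eps)%R %% 3 = cls theta %% 3)%N].
  have : ((cls (w - 1)%R %% 3 = cls theta %% 3) \/
    (cls (w - eps ^+ 2)%R %% 3 = cls theta %% 3) \/
  (cls (w - eps)%R %% 3 = cls theta %% 3))%N.
    move: tw; rewrite /transversal3 -!/cls; move: (cls _) (cls _) (cls _) (cls _) => a b c d;
      clear; lia.
  by case=> [|[|]]; [apply: Or31 | apply: Or32 | apply: Or33].
case=> wth.
- by case: Qw => *; apply: (family_cls3 w0).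
- by case: Q1 => *; apply: (@family_cls3 (eps * w)) => //; rewrite E1.
- by case: Q2 => *; apply: (@family_cls3 (eps * (eps * w))) => //; rewrite E2 E1'.
Qed.

End Constructions.

Theorem theorem6p2 (q n : nat) (hq : prime_power q) (hqn : q = 18 * n + 1)
    (hn : odd n) (F : finFieldType) (hF : #|F| = q) :
  exists P : {set {set 'Z_3 * F}},
    is_PDF (nseq (12 * n + 1) 3 ++ nseq (3 * n) 6) 3 P /\
    is_base_parallel_class_HS [:: 3; 6] (3 * q) P.
Proof.
have cF : #|F| = 18 * n + 1 by rewrite hF.
have [g gP] : exists g : F, ((18 * n)%N.-primitive_root g)%R.
  apply: prim_root_exists; last by rewrite cF addn1.
  by case: n hn {hqn cF} => // m _; rewrite muln_gt0.
by rewrite -hF; exact: starter_family_exists cF gP hn.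
Qed.
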